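(* Let $(\mathfrak{M},g)$ be a compact, orientable, connected, smooth Riemannian manifold of dimension $d<\min\{4,D\}$ whose boundary is either empty or smooth, and let $\boldsymbol{f}=(f_1,\dots,f_D):\mathfrak{M}\to\mathbb{R}^D$ be a (smooth) embedding. Let $g_{\boldsymbol{f}}$ be the pullback metric on $\mathfrak{M}$, with Levi-Civita connection $\nabla^{\boldsymbol{f}}$, and let $\nabla$ be the Levi-Civita connection of $g$. Then $$\|\nabla^2\boldsymbol{f}\|_{L^2(\mathfrak{M})}^2=\|\mathbf{II}\|_{L^2(\mathfrak{M})}^2+\sum_{i,k=1}^d\int_{\mathfrak{M}}\Big\|\,d\boldsymbol{f}\big(\nabla^{\boldsymbol{f}}_{e_i}e_k-\nabla_{e_i}e_k\big)\big|_{\boldsymbol{f}(\boldsymbol{m})}\Big\|_{\mathbb{R}^D}^2\,d\mathrm{vol}_g(\boldsymbol{m}),$$ where $\{e_k\}_{k=1}^d$ is any $g$-orthonormal basis of the tangent space $T_{\boldsymbol{m}}\mathfrak{M}$ at $\boldsymbol{m}\in\mathfrak{M}$.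
   Context: Embedding: $\boldsymbol{f}$ is a homeomorphism onto its image with the subspace topology and $d\boldsymbol{f}:T_{\boldsymbol{m}}\mathfrak{M}\to\mathbb{R}^D$ is injective for every $\boldsymbol{m}$. The pullback metric is $g_{\boldsymbol{f}}(u,v)=\delta(d\boldsymbol{f}(u),d\boldsymbol{f}(v))$, $\delta$ the Euclidean metric on $\mathbb{R}^D$. $\mathbf{II}(u,v)\in N_{\boldsymbol{f}(\boldsymbol{m})}\boldsymbol{f}(\mathfrak{M})$ is the second fundamental form of the embedded submanifold $\boldsymbol{f}(\mathfrak{M})\subset\mathbb{R}^D$, regarded as a tensor on $\mathfrak{M}$: the normal component in $\overline{\nabla}_{d\boldsymbol{f}(u)}(d\boldsymbol{f}(v))=d\boldsymbol{f}(\nabla^{\boldsymbol{f}}_u v)+\mathbf{II}(u,v)$, with $\overline{\nabla}$ the Euclidean connection. For scalar $f$, $\nabla^2 f(u,v)=u(vf)-(\nabla_u v)f$ (Hessian with respect to $g$), and $\nabla^2\boldsymbol{f}=(\nabla^2 f_1,\dots,\nabla^2 f_D)$. For an $\mathbb{R}^D$-valued $(0,2)$-tensor $\boldsymbol{J}$, $\|\boldsymbol{J}\|_{L^2(\mathfrak{M})}^2=\int_{\mathfrak{M}}\sum_{i,k=1}^d\|\boldsymbol{J}(e_i,e_k)\|_{\mathbb{R}^D}^2\,d\mathrm{vol}_g$ with $\{e_i\}$ a $g$-orthonormal basis at each point. The quantity $\nabla^{\boldsymbol{f}}_u v-\nabla_u v$ is tensorial in $(u,v)$, so depends only on the values of $u,v$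 at the point. *)

(* Defs.v *)
(* A smooth d-manifold with (possibly empty) boundary is a topological space M
   with a family of charts A : M -> chart R d M, indexed by M, where A m is a
   chart around m.  The charts take values in the closed half-space
   {x | 0 <= x_0} of R^d; a manifold without boundary is one whose charts all
   miss {x | x_0 = 0}.  The smooth structure is the one generated by this
   atlas.

   The tangent space T_m M is represented by 'rV[R]_d through the chart A m:
   the row vector v stands for \sum_i v_i (d/dx_i)|_m, where x_0, ..., x_{d-1}
   are the coordinates of A m.  A vector field is then a map M -> 'rV[R]_d. *)
From HB Require Import structures.
From mathcomp Require Import all_boot all_order all_algebra.
From mathcomp Require Import all_classical all_reals all_analysis.
Import Order.TTheory GRing.Theory Num.Theory.
Import numFieldNormedType.Exports.

Set Implicit Arguments.
Unset Strict Implicit.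
Unset Printing Implicit Defensive.

Local Open Scope classical_set_scope.
Local Open Scope ring_scope.

Section euclidean.
Context {R : realType}.

Definition dot n (u v : 'rV[R]_n) : R := \sum_a u 0 a * v 0 a.

(* [enorm2 u] is the square of the Euclidean norm; the library's `|u| on
   matrices is the sup norm. *)
Definition enorm2 n (u : 'rV[R]_n) : R := dot u u.

(* [kermx T^T] is the Euclidean orthogonal complement of the row space of
   [T]. *)
Definition normal_part n k (T : 'M[R]_(k, n)) (w : 'rV[R]_n) : 'rV[R]_n :=
  w *m proj_mx (kermx T^T) <<T>>%MS.

Section calculus.
Context {n : nat}.
Implicit Types (F G : 'rV[R]_n -> R) (x : 'rV[R]_n).

Fixpoint iter_partial (s : seq 'I_n) F : 'rV[R]_n -> R :=
  if s is i :: s' then fun x => 'D_(delta_mx 0 i) (iter_partial s' F) x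
  else F.

Definition smooth_open (O : set 'rV[R]_n) F : Prop :=
  forall s x, O x -> differentiable (iter_partial s F) x.

(* Smoothness on an arbitrary subset: local extendability to a smooth function
   on an open set of R^n. *)
Definition smooth_on (S : set 'rV[R]_n) F : Prop :=
  forall x, S x -> exists (O : set 'rV[R]_n) G,
    [/\ open O, O x, smooth_open O G & forall y, O y -> S y -> G y = F y].

(* One-sided partial derivative.  It only evaluates F at x + t e_i with
   t >= 0, hence inside the half-space when x is in the half-space; where F is
   smooth on a relatively open subset of the half-space it is the partial
   derivative of any smooth extension of F. *)
Definition rpartial (i : 'I_n) F x : R :=
  lim ((fun t : R => (F (x + t *: delta_mx 0 i) - F x) / t) @ 0^'+).

(* For n = 0 this is all of R^0. *)
Definition halfspace : set 'rV[R]_n :=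
  [set x | forall i : 'I_n, val i = 0%N -> 0 <= x 0 i].

End calculus.

(* Integral over R^n of a nonnegative Borel function with respect to Lebesgue
   measure, as an iterated integral (Tonelli). *)
Fixpoint rn_integral n : ('rV[R]_n -> \bar R) -> \bar R :=
  if n is n'.+1 return ('rV[R]_n -> \bar R) -> \bar R then
    fun F => (\int[@lebesgue_measure R]_x
                rn_integral (fun y : 'rV[R]_n' => F (row_mx x%:M y)))%E
  else fun F => F 0.

End euclidean.

Record chart (R : realType) (d : nat) (M : Type) := Chart {
  cdom : set M;
  cmap : M -> 'rV[R]_d;
  cinv : 'rV[R]_d -> M }.

Definition cimg R d M (c : chart R d M) : set 'rV[R]_d := cmap c @` cdom c.

(* Homeomorphism from an open set onto a relatively open subset of the
   half-space. *)
Definition is_chart R d (M : topologicalType) (c : chart R d M) : Prop :=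
  [/\ open (cdom c),
      exists2 O, open O & cimg c = O `&` halfspace,
      forall m, cdom c m -> cinv c (cmap c m) = m,
      {within cdom c, continuous (cmap c)} &
      {within cimg c, continuous (cinv c)}].

Definition smooth_atlas R d (M : topologicalType) (A : M -> chart R d M) :=
  [/\ forall m, is_chart (A m),
      forall m, cdom (A m) m &
      forall p q k,
        smooth_on (cmap (A p) @` (cdom (A p) `&` cdom (A q)))
                  (fun x => cmap (A q) (cinv (A p) x) 0 k)].

(* M with its Borel sigma-algebra. *)
Definition borel (M : ptopologicalType) := g_sigma_algebraType (@open M).

Section manifold.
Context {R : realType} {d : nat} {M : ptopologicalType}.
Variable A : M -> chart R d M.
Implicit Types (h : M -> R) (X Y Z : M -> 'rV[R]_d) (m p : M).

Definition smooth_fun h : Prop :=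
  forall p, smooth_on (cimg (A p)) (h \o cinv (A p)).

(* v h, for v in T_m M *)
Definition tapp m (v : 'rV[R]_d) h : R :=
  \sum_i v 0 i * rpartial i (h \o cinv (A m)) (cmap (A m) m).

(* X h *)
Definition vapp X h : M -> R := fun m => tapp m (X m) h.

(* The i-th coordinate vector at m of the chart A p. *)
Definition coord_vec p i m : 'rV[R]_d :=
  \row_k rpartial i (fun x => cmap (A m) (cinv (A p) x) 0 k) (cmap (A p) m).

(* The components of X in each chart are smooth. *)
Definition smooth_field X : Prop :=
  forall p j, smooth_on (cimg (A p))
    ((fun m => tapp m (X m) (fun m' => cmap (A p) m' 0 j)) \o cinv (A p)).

(* [o m] tells whether the frame of A m is positively oriented at m; the
   orientation of the frame of A p is required to be locally constant on the
   domain of A p.  (An atlas of half-space charts with positive transition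
   Jacobians would be too strong: [0, 1] has none.) *)
Definition orientable : Prop :=
  exists o : M -> bool, forall p m, cdom (A p) m ->
    let pos q := (0 < \det (\matrix_(i < d) coord_vec p i q)) == o q in
    \forall q \near m, pos q = pos m.

Section metric.
Variable g : M -> 'rV[R]_d -> 'rV[R]_d -> R.

(* Gram matrix at m of the coordinate frame of A p. *)
Definition gram p m : 'M[R]_d :=
  \matrix_(i, j) g m (coord_vec p i m) (coord_vec p j m).

Definition riemannian_metric : Prop :=
  [/\ forall m a u v w, g m (a *: u + v) w = a * g m u w + g m v w,
      forall m u v, g m u v = g m v u,
      forall m u, u != 0 -> 0 < g m u u &
      forall p i j, smooth_on (cimg (A p))
                      ((fun m => gram p m i j) \o cinv (A p))].

Definition riemannian_volume (vol : {measure set (borel M) -> \bar R}) : Prop :=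
  forall p (B : set (borel M)), measurable B -> B `<=` cdom (A p) ->
    vol B = rn_integral (fun x =>
      (\1_(cmap (A p) @` B) x * Num.sqrt (\det (gram p (cinv (A p) x))))%:E).

Definition orthonormal_frame m (e : 'I_d -> 'rV[R]_d) : Prop :=
  forall i k, g m (e i) (e k) = (i == k)%:R.

(* A chosen g-orthonormal basis of T_m M; d orthonormal vectors of the
   d-dimensional space T_m M are automatically a basis. *)
Definition onb m : 'I_d -> 'rV[R]_d := xget (fun=> 0) (orthonormal_frame m).

(* Squared L^2 norm of an R^D-valued (0,2)-tensor. *)
Definition L2norm2 (vol : {measure set (borel M) -> \bar R}) D
    (J : M -> 'rV[R]_d -> 'rV[R]_d -> 'rV[R]_D) : \bar R :=
  (\int[vol]_m (\sum_i \sum_k enorm2 (J m (onb m i) (onb m k)))%:E)%E.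

End metric.

Definition affine_connection
    (nabla : (M -> 'rV[R]_d) -> (M -> 'rV[R]_d) -> M -> 'rV[R]_d) : Prop :=
  [/\ forall X Y, smooth_field X -> smooth_field Y -> smooth_field (nabla X Y),
      forall h X Y Z, smooth_fun h ->
        smooth_field X -> smooth_field Y -> smooth_field Z ->
        forall m, nabla (fun q => h q *: X q + Y q) Z m
                  = h m *: nabla X Z m + nabla Y Z m,
      forall X Y Z, smooth_field X -> smooth_field Y -> smooth_field Z ->
        forall m, nabla X (fun q => Y q + Z q) m = nabla X Y m + nabla X Z m &
      forall h X Y, smooth_fun h -> smooth_field X -> smooth_field Y ->
        forall m, nabla X (fun q => h q *: Y q) m
                  = h m *: nabla X Y m + vapp X h m *: Y m].

(* The torsion is tested on functions, where [X, Y] h = X (Y h) - Y (X h). *)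
Definition levi_civita (g : M -> 'rV[R]_d -> 'rV[R]_d -> R)
    (nabla : (M -> 'rV[R]_d) -> (M -> 'rV[R]_d) -> M -> 'rV[R]_d) : Prop :=
  [/\ affine_connection nabla,
      forall X Y h, smooth_field X -> smooth_field Y -> smooth_fun h ->
        forall m, vapp (nabla X Y) h m - vapp (nabla Y X) h m
                  = vapp X (vapp Y h) m - vapp Y (vapp X h) m &
      forall X Y Z, smooth_field X -> smooth_field Y -> smooth_field Z ->
        forall m, vapp X (fun q => g q (Y q) (Z q)) m
                  = g m (nabla X Y m) (Z m) + g m (Y m) (nabla X Z m)].

(* Value at (u, v) in T_m M of a tensor given by its action on vector fields:
   extend u and v to smooth fields and evaluate at m. *)
Definition extend m (v : 'rV[R]_d) : M -> 'rV[R]_d :=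
  xget (fun=> 0) [set V | smooth_field V /\ V m = v].

Definition tensor_at T (J : (M -> 'rV[R]_d) -> (M -> 'rV[R]_d) -> M -> T)
    m (u v : 'rV[R]_d) : T :=
  J (extend m u) (extend m v) m.

Section embedding.
Context {D : nat}.
Variable f : M -> 'rV[R]_D.

Definition component (a : 'I_D) : M -> R := fun m => f m 0 a.

Definition differential m (v : 'rV[R]_d) : 'rV[R]_D :=
  \row_a tapp m v (component a).

Definition smooth_embedding : Prop :=
  [/\ forall a, smooth_fun (component a),
      injective f,
      continuous f,
      forall U, open U -> exists2 O, open O & f @` U = O `&` range f &
      forall m, injective (differential m)].

Definition pullback_metric m (u v : 'rV[R]_d) : R :=
  dot (differential m u) (differential m v).

(* Its row space is df(T_m M). *)
Definition tangent_mx m : 'M[R]_(d, D) :=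
  \matrix_(i < d) differential m (delta_mx 0 i).

(* The Euclidean covariant derivative of df(V) in the direction df(U) is the
   componentwise derivative U (V f_a), as df(V)_a = V f_a. *)
Definition euclidean_derivative (U V : M -> 'rV[R]_d) m : 'rV[R]_D :=
  \row_a vapp U (vapp V (component a)) m.

Definition second_fundamental_form : M -> 'rV[R]_d -> 'rV[R]_d -> 'rV[R]_D :=
  tensor_at (fun U V m =>
    normal_part (tangent_mx m) (euclidean_derivative U V m)).

Definition hessian
    (nabla : (M -> 'rV[R]_d) -> (M -> 'rV[R]_d) -> M -> 'rV[R]_d) :
    M -> 'rV[R]_d -> 'rV[R]_d -> 'rV[R]_D :=
  tensor_at (fun U V m =>
    \row_a (vapp U (vapp V (component a)) m
            - vapp (nabla U V) (component a) m)).

End embedding.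

Definition connection_difference
    (nabla' nabla : (M -> 'rV[R]_d) -> (M -> 'rV[R]_d) -> M -> 'rV[R]_d) :
    M -> 'rV[R]_d -> 'rV[R]_d -> 'rV[R]_d :=
  tensor_at (fun U V m => nabla' U V m - nabla U V m).

End manifold.

(* Main.v *)
Require Import Defs.
From HB Require Import structures.
From mathcomp Require Import all_boot all_order all_algebra.
From mathcomp Require Import all_classical all_reals all_analysis.
From mathcomp Require Import measurable_realfun.
Import Order.TTheory GRing.Theory Num.Theory.
Import numFieldNormedType.Exports.
Local Open Scope classical_set_scope.
Local Open Scope ring_scope.

(** Subtracting [df (nabla_U V)] from the Euclidean derivative [D_U (df V)] gives
    the Hessian of [f] for the connection [nabla].  For the Levi-Civita
    connection of the pullback metric this vector is normal to the image, so it
    is the second fundamental form ([second_fundamental_formE]); normality is the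
    uniqueness argument of the Levi-Civita connection ([dot_hess0]): paired with
    [df Z], the Hessian is symmetric in its first two arguments and antisymmetric
    in its last two.  Hence, at each point,
      Hessian for [nabla] = [II] + [df (nablaf_U V - nabla_U V)],
    a sum of a normal and a tangent vector ([hessian_split],
    [second_fundamental_form_orth]), and Pythagoras' theorem gives the identity
    of the integrands.

    Smooth fields with prescribed values, which evaluating a tensor at a point
    requires, come from the embedding itself: the tangential projections
    [E_1, ..., E_D] of the standard basis of [R^D] are globally defined smooth
    fields spanning every tangent space, and every field is
    [V = \sum_a (V f_a) E_a] ([field_expansion]).  By linearity over smooth
    functions this makes the Hessian at a point a bilinear expression in
    [df (U m)] and [df (V m)] whose coefficients are smooth functions
    ([hess_tensorial]).

    The integral is additive once the integrands are known to be measurable, and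
    an orthonormal frame may depend on the point in an arbitrary way.  But the sum
    of squared norms over a frame is a sum of traces of products of the
    coefficient matrices and of the matrix [K] of the [g]-products of the covectors
    [df_a], which does not involve the frame ([frame_sumE]).  Since [K] is smooth
    ([smooth_cometric]), so is that sum, and it is Borel measurable; the same
    formula shows that the frame [e] and the one chosen in the definition of the
    norm give the same value. *)

Set Implicit Arguments.
Unset Strict Implicit.
Unset Printing Implicit Defensive.

(** * Normal and tangential components *)

Section linear_algebra.
Context {R : realType}.

Lemma dotE n (u v : 'rV[R]_n) : dot u v = (u *m v^T) 0 0.
Proof. by rewrite mxE; apply: eq_bigr => a _; rewrite !mxE. Qed.

Lemma dotC n (u v : 'rV[R]_n) : dot u v = dot v u.
Proof. by apply: eq_bigr => a _; rewrite mulrC. Qed.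

Lemma dotDl n (u v w : 'rV[R]_n) : dot (u + v) w = dot u w + dot v w.
Proof. by rewrite !dotE mulmxDl mxE. Qed.

Lemma enorm2_ge0 n (u : 'rV[R]_n) : 0 <= enorm2 u.
Proof. by apply: sumr_ge0 => a _; rewrite -expr2 sqr_ge0. Qed.

Lemma enorm2_eq0 n (u : 'rV[R]_n) : enorm2 u = 0 -> u = 0.
Proof.
move=> /eqP; rewrite psumr_eq0; last by move=> a _; rewrite -expr2 sqr_ge0.
move=> /allP u0; apply/rowP => a; rewrite mxE; apply/eqP.
by have := u0 a (mem_index_enum _); rewrite mulf_eq0 orbb.
Qed.

Lemma enorm2D_orth n (u v : 'rV[R]_n) :
  dot u v = 0 -> enorm2 (u + v) = enorm2 u + enorm2 v.
Proof.
move=> uv0; rewrite /enorm2 dotDl ![dot _ (u + v)]dotC !dotDl uv0 dotC uv0.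
by rewrite addr0 add0r.
Qed.

(** A vector of the row space of [T] that is killed by [T^T] is orthogonal to
    itself. *)
Lemma capmx_ker_tr n k (T : 'M[R]_(k, n)) : (kermx T^T :&: <<T>>)%MS = 0.
Proof.
apply/eqP; rewrite -submx0; apply/rV_subP => u.
rewrite sub_capmx genmxE => /andP[/sub_kermxP uT /submxP[y uE]].
rewrite submx0; apply/eqP; apply: enorm2_eq0.
by rewrite /enorm2 dotE [X in _ *m X^T]uE trmx_mul mulmxA uT mul0mx mxE.
Qed.

Lemma normal_partD n k (T : 'M[R]_(k, n)) (u v : 'rV[R]_n) :
  normal_part T (u + v) = normal_part T u + normal_part T v.
Proof. exact: mulmxDl. Qed.

Lemma normal_part_normal n k (T : 'M[R]_(k, n)) (w : 'rV[R]_n) :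
  w *m T^T = 0 -> normal_part T w = w.
Proof.
by move=> wT; apply: proj_mx_id; [exact: capmx_ker_tr|apply/sub_kermxP].
Qed.

Lemma normal_part_tangent n k (T : 'M[R]_(k, n)) (v : 'rV[R]_k) :
  normal_part T (v *m T) = 0.
Proof.
by apply: proj_mx_0; [exact: capmx_ker_tr|rewrite genmxE submxMl].
Qed.

(** Over an ordered field, [u T T^T = 0] forces [u T] to have norm zero. *)
Lemma gram_unitmx n k (T : 'M[R]_(k, n)) : row_free T -> T *m T^T \in unitmx.
Proof.
move=> Tfree; rewrite -row_free_unit -kermx_eq0 -submx0.
apply/rV_subP => u /sub_kermxP; rewrite mulmxA => uTT.
rewrite submx0 -(mulmx_free_eq0 _ Tfree); apply/eqP/enorm2_eq0.
by rewrite /enorm2 dotE trmx_mul mulmxA uTT mul0mx mxE.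
Qed.

End linear_algebra.

(** * Smooth functions on open and on arbitrary sets *)

Lemma near_eq_differentiable (R : numFieldType) (V W : normedModType R)
    (F G : V -> W) (x : V) :
  {near x, F =1 G} -> differentiable G x -> differentiable F x.
Proof.
move=> FG dG; have FGx : F x = G x by exact: nbhs_singleton FG.
have eqF : F \o shift x = cst (F x) + 'd G x +o_ 0 id.
  have [_ /eqaddoP Go] := (diff_locallyP _ _).1 dG.
  apply/eqaddoP => _/posnumP[e].
  have {}Go := Go e%:num [gt0 of e%:num].
  have FG0 : \forall y \near 0, F (y + x) = G (y + x).
    move: FG; rewrite -{1}(add0r x) => FG.
    have : (fun y => y + x) @ 0 --> 0 + x.
      by apply: cvgD; [exact: cvg_id|exact: cvg_cst].
    by move=> /(_ _ FG).
  by apply: filterS2 FG0 Go => y Fy; rewrite /= !fctE /= Fy FGx.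
have dE : 'd F x = 'd G x :> (_ -> _).
  by apply: diff_unique => //; exact: diff_continuous.
apply/diff_locallyP; split; last by rewrite dE.
by rewrite dE; exact: diff_continuous.
Qed.

Section smooth_open.
Context {R : realType} {n : nat}.
Implicit Types (F G : 'rV[R]_n -> R) (x : 'rV[R]_n) (O : set 'rV[R]_n).

(** Differentiability of all partial derivatives of order at most [k].  The
    recursion splits off the derivative taken first, whereas [iter_partial] splits
    off the one taken last; this is the form in which the rules of
    differentiation give closure properties by induction. *)
Fixpoint Ck k O F : Prop :=
  if k is k'.+1 then
    (forall x, O x -> differentiable F x) /\
    (forall i, Ck k' O (fun x => 'D_(delta_mx 0 i) F x))
  else forall x, O x -> differentiable F x.

Lemma iter_partial_rcons s i F :
  iter_partial (rcons s i) F = iter_partial s (fun x => 'D_(delta_mx 0 i) F x).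
Proof. by elim: s => //= j s ->. Qed.

Lemma CkP O F : smooth_open O F <-> forall k, Ck k O F.
Proof.
split=> [OF k|].
  elim: k F OF => [F /(_ [::])|k IH F OF] //=.
  split=> [|i]; first exact: (OF [::]).
  by apply: IH => s; rewrite -iter_partial_rcons; exact: OF.
move=> OF s; elim/last_ind: s F OF => [F /(_ 0%N)|s i IH F OF] //.
by rewrite iter_partial_rcons; apply: IH => k; have [_ /(_ i)] := OF k.+1.
Qed.

Lemma Ck_diff k O F x : Ck k O F -> O x -> differentiable F x.
Proof. by case: k => [|k] => [/(_ x)|[/(_ x)]]. Qed.

Lemma CkW k O F : Ck k.+1 O F -> Ck k O F.
Proof.
elim: k F => [F []|k IH F [dF DF]] //.
by split=> // i; apply: IH; exact: DF.
Qed.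

Lemma Ck_sub k O O' F : O' `<=` O -> Ck k O F -> Ck k O' F.
Proof.
move=> sO; elim: k F => [F dF x /sO|k IH F [dF DF]]; first exact: dF.
by split=> [x /sO|i]; [exact: dF|apply: IH; exact: DF].
Qed.

Lemma eq_Ck k O F G : open O -> (forall x, O x -> F x = G x) ->
  Ck k O F -> Ck k O G.
Proof.
move=> oO; elim: k F G => [|k IH] F G FG; have nFG x : O x -> {near x, G =1 F}.
- by move=> Ox; apply: filterS (open_nbhs_nbhs (conj oO Ox)) => y /FG.
- by move=> dF x Ox; apply: near_eq_differentiable (nFG x Ox) (dF x Ox).
- by move=> Ox; apply: filterS (open_nbhs_nbhs (conj oO Ox)) => y /FG.
move=> [dF DF]; split=> [x Ox|i].
  exact: near_eq_differentiable (nFG x Ox) (dF x Ox).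
apply: IH (DF i) => x Ox; apply: near_eq_derive.
by apply: filterS (nFG x Ox).
Qed.

Lemma Ck_cst k O (c : R) : Ck k O (fun=> c).
Proof.
elim: k c => [|k IH] c; first by move=> x _; exact: differentiable_cst.
split=> [x _|i]; first exact: differentiable_cst.
have -> : (fun x => 'D_(delta_mx 0 i) (fun=> c) x) = fun=> 0 :> R.
  by apply/funext => x; exact: derive_cst.
exact: IH.
Qed.

Lemma CkD k O F G : open O ->
  Ck k O F -> Ck k O G -> Ck k O (fun x => F x + G x).
Proof.
move=> oO; elim: k F G => [F G dF dG x Ox|k IH F G [dF DF] [dG DG]].
  by apply: differentiableD; [exact: dF|exact: dG].
split=> [x Ox|i]; first by apply: differentiableD; [exact: dF|exact: dG].
apply: (eq_Ck oO) (IH _ _ (DF i) (DG i)) => x Ox.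
by rewrite [RHS]deriveD //; apply: diff_derivable; [exact: dF|exact: dG].
Qed.

Lemma CkM k O F G : open O ->
  Ck k O F -> Ck k O G -> Ck k O (fun x => F x * G x).
Proof.
move=> oO; elim: k F G => [F G dF dG x Ox|k IH F G CF CG].
  by apply: differentiableM; [exact: dF|exact: dG].
have [[dF DF] [dG DG]] := (CF, CG).
split=> [x Ox|i]; first by apply: differentiableM; [exact: dF|exact: dG].
apply: (eq_Ck oO) (CkD oO (IH _ _ (CkW CF) (DG i)) (IH _ _ (CkW CG) (DF i))).
move=> x Ox.
by rewrite [RHS]deriveM //; apply: diff_derivable; [exact: dF|exact: dG].
Qed.

Lemma CkV k O F : open O -> (forall x, O x -> F x != 0) ->
  Ck k O F -> Ck k O (fun x => (F x)^-1).
Proof.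
move=> oO F0; elim: k => [dF x Ox|k IH CF].
  by apply: differentiableV; [exact: dF|exact: F0].
have [dF DF] := CF.
split=> [x Ox|i]; first by apply: differentiableV; [exact: dF|exact: F0].
have CV := IH (CkW CF).
apply: (eq_Ck oO) (CkM oO (CkM oO (Ck_cst k O (-1)) (CkM oO CV CV)) (DF i)).
move=> x Ox; rewrite [RHS]deriveV; last exact: diff_derivable (dF x Ox).
  by rewrite /= mulN1r -invfM -expr2.
exact: F0.
Qed.

End smooth_open.

Section smooth_on.
Context {R : realType} {n : nat}.
Implicit Types (F G : 'rV[R]_n -> R) (x : 'rV[R]_n) (O S : set 'rV[R]_n).

Lemma eq_smooth_on S F G : (forall x, S x -> F x = G x) ->
  smooth_on S F -> smooth_on S G.
Proof.
move=> FG sF x Sx; have [U [H [oU Ux sH HF]]] := sF x Sx.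
by exists U, H; split=> // y Uy Sy; rewrite HF ?FG.
Qed.

Lemma smooth_on_cst S (c : R) : smooth_on S (fun=> c).
Proof.
move=> x Sx; exists setT, (fun=> c); split=> //; first exact: openT.
by apply/CkP => k; exact: Ck_cst.
Qed.

Lemma smooth_onD S F G :
  smooth_on S F -> smooth_on S G -> smooth_on S (fun x => F x + G x).
Proof.
move=> sF sG x Sx.
have [U [H [oU Ux /CkP sH HF]]] := sF x Sx.
have [P [K [oP Px /CkP sK KG]]] := sG x Sx.
exists (U `&` P), (fun x => H x + K x); split=> //; first exact: openI.
  apply/CkP => k; apply: CkD; first exact: openI.
    by apply: Ck_sub (sH k); exact: subIsetl.
  by apply: Ck_sub (sK k); exact: subIsetr.
by move=> y [Uy Py] Sy; rewrite HF // KG.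
Qed.

Lemma smooth_onM S F G :
  smooth_on S F -> smooth_on S G -> smooth_on S (fun x => F x * G x).
Proof.
move=> sF sG x Sx.
have [U [H [oU Ux /CkP sH HF]]] := sF x Sx.
have [P [K [oP Px /CkP sK KG]]] := sG x Sx.
exists (U `&` P), (fun x => H x * K x); split=> //; first exact: openI.
  apply/CkP => k; apply: CkM; first exact: openI.
    by apply: Ck_sub (sH k); exact: subIsetl.
  by apply: Ck_sub (sK k); exact: subIsetr.
by move=> y [Uy Py] Sy; rewrite HF // KG.
Qed.

Lemma smooth_onV S F : (forall x, S x -> F x != 0) ->
  smooth_on S F -> smooth_on S (fun x => (F x)^-1).
Proof.
move=> F0 sF x Sx; have [U [H [oU Ux /CkP sH HF]]] := sF x Sx.
have Hx0 : H x != 0 by rewrite HF // F0.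
have Hcont : {for x, continuous H}.
  exact/differentiable_continuous/(Ck_diff (sH 0%N)).
have nH : \forall y \near x, H y != 0.
  exact: (Hcont _ (open_nbhs_nbhs (conj (@open_neq R 0) Hx0))).
pose P := U `&` interior [set y | H y != 0].
exists P, (fun x => (H x)^-1); split.
- by apply: openI => //; exact: open_interior.
- by split.
- apply/CkP => k; apply: CkV.
  + by apply: openI => //; exact: open_interior.
  + by move=> y [_ /interior_subset].
  + by apply: Ck_sub (sH k); exact: subIsetl.
- by move=> y [Uy _] Sy; rewrite HF.
Qed.

Lemma smooth_on_sum (I : Type) (r : seq I) (P : pred I)
    (F : I -> 'rV[R]_n -> R) S :
  (forall i, P i -> smooth_on S (F i)) ->
  smooth_on S (fun x => \sum_(i <- r | P i) F i x).
Proof.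
move=> sF; elim: r => [|i r IH].
  apply: (@eq_smooth_on _ (fun=> 0)); last exact: smooth_on_cst.
  by move=> x _; rewrite big_nil.
case Pi : (P i); last first.
  by apply: (eq_smooth_on _ IH) => x _; rewrite big_cons Pi.
apply: (eq_smooth_on _ (smooth_onD (sF _ Pi) IH)) => x _.
by rewrite big_cons Pi.
Qed.

Lemma smooth_on_prod (I : Type) (r : seq I) (P : pred I)
    (F : I -> 'rV[R]_n -> R) S :
  (forall i, P i -> smooth_on S (F i)) ->
  smooth_on S (fun x => \prod_(i <- r | P i) F i x).
Proof.
move=> sF; elim: r => [|i r IH].
  apply: (@eq_smooth_on _ (fun=> 1)); last exact: smooth_on_cst.
  by move=> x _; rewrite big_nil.
case Pi : (P i); last first.
  by apply: (eq_smooth_on _ IH) => x _; rewrite big_cons Pi.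
apply: (eq_smooth_on _ (smooth_onM (sF _ Pi) IH)) => x _.
by rewrite big_cons Pi.
Qed.

Definition smooth_mx p q S (B : 'rV[R]_n -> 'M[R]_(p, q)) :=
  forall i j, smooth_on S (fun x => B x i j).

Lemma smooth_mxM p q r S (B : 'rV[R]_n -> 'M[R]_(p, q))
    (C : 'rV[R]_n -> 'M[R]_(q, r)) :
  smooth_mx S B -> smooth_mx S C -> smooth_mx S (fun x => B x *m C x).
Proof.
move=> sB sC i j; pose H x := \sum_k B x i k * C x k j.
apply: (@eq_smooth_on _ H) => [x _|]; first by rewrite mxE.
by apply: smooth_on_sum => k _; exact: smooth_onM.
Qed.

Lemma smooth_mx_tr p q S (B : 'rV[R]_n -> 'M[R]_(p, q)) :
  smooth_mx S B -> smooth_mx S (fun x => (B x)^T).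
Proof.
by move=> sB i j; apply: (eq_smooth_on _ (sB j i)) => x _; rewrite mxE.
Qed.

Lemma smooth_on_det p S (B : 'rV[R]_n -> 'M[R]_p) :
  smooth_mx S B -> smooth_on S (fun x => \det (B x)).
Proof.
move=> sB; apply: smooth_on_sum => s _; apply: smooth_onM.
  exact: smooth_on_cst.
by apply: smooth_on_prod => i _; exact: sB.
Qed.

(** Cramer's rule makes the entries of the inverse rational functions of the
    entries of the matrix. *)
Lemma smooth_mxV p S (B : 'rV[R]_n -> 'M[R]_p) :
  (forall x, S x -> B x \in unitmx) ->
  smooth_mx S B -> smooth_mx S (fun x => invmx (B x)).
Proof.
move=> uB sB i j.
pose H x := (\det (B x))^-1 * ((-1) ^+ (j + i) * \det (row' j (col' i (B x)))).
apply: (@eq_smooth_on _ H) => [x /uB Bx|].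
  by rewrite /invmx Bx !mxE.
apply: smooth_onM.
  apply: smooth_onV; last exact: smooth_on_det.
  by move=> x /uB; rewrite unitmxE unitfE.
apply: smooth_onM; first exact: smooth_on_cst.
apply: smooth_on_det => k l.
by apply: (eq_smooth_on _ (sB (lift j k) (lift i l))) => x _; rewrite !mxE.
Qed.

End smooth_on.

(** * One-sided partial derivatives in the half-space *)

Section one_sided.
Context {R : realType} {n : nat}.
Implicit Types (F G : 'rV[R]_n -> R) (x : 'rV[R]_n) (S : set 'rV[R]_n).

Definition rel_open S := exists2 O, open O & S = O `&` halfspace.

Lemma rel_open_near S x : rel_open S -> S x ->
  \forall y \near x, halfspace y -> S y.
Proof.
move=> [U oU ->] [Ux _].
by apply: filterS (open_nbhs_nbhs (conj oU Ux)) => y Uy hy.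
Qed.

Lemma rel_open_half S x : rel_open S -> S x -> halfspace x.
Proof. by move=> [U _ ->] []. Qed.

Lemma halfspace_shift x i (t : R) :
  halfspace x -> 0 <= t -> halfspace (x + t *: delta_mx 0 i).
Proof.
by move=> hx t0 k k0; rewrite !mxE addr_ge0 ?hx // mulr_ge0.
Qed.

Lemma shift_cvg x i : x + t *: delta_mx 0 i @[t --> (0:R)^'+] --> x.
Proof.
rewrite -[X in _ --> X](addr0 x) -(scale0r (delta_mx 0 i : 'rV[R]_n)).
apply: cvgD; first exact: cvg_cst.
by apply: cvgZr_tmp; apply: cvg_at_right_filter; exact: cvg_id.
Qed.

(** The segments along which [rpartial] differentiates stay in the half-space, so
    values outside it do not matter. *)
Lemma eq_rpartial i F G x : halfspace x ->
  (\forall y \near x, halfspace y -> F y = G y) ->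
  rpartial i F x = rpartial i G x.
Proof.
move=> hx FG; have FGx : F x = G x by exact: (nbhs_singleton FG).
have FGt : \forall t \near (0:R)^'+,
    F (x + t *: delta_mx 0 i) = G (x + t *: delta_mx 0 i).
  have FGt : \forall t \near (0:R)^'+, _ := @shift_cvg x i _ FG.
  near=> t; apply: (near FGt t) => //.
  by apply: halfspace_shift => //; near: t; exact: nbhs_right_ge.
rewrite /rpartial; congr lim; rewrite eqEsubset; split.
  by apply: near_eq_cvg; apply: filterS FGt => t ->; rewrite FGx.
by apply: near_eq_cvg; apply: filterS FGt => t ->; rewrite FGx.
Unshelve. all: by end_near. Qed.

Lemma rpartialE i G x : derivable G x (delta_mx 0 i) ->
  rpartial i G x = 'D_(delta_mx 0 i) G x.
Proof.
move=> dG; apply: cvg_lim => //.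
have /cvg_dnbhs_at_right := dG; apply: cvg_trans.
apply: near_eq_cvg; apply: nearW => t /=.
by rewrite [_ *: _ + x]addrC [RHS]mulrC.
Qed.

Lemma smooth_on_ext S F x : rel_open S -> smooth_on S F -> S x ->
  exists U G, [/\ open U, U x, smooth_open U G &
    forall y, U y -> halfspace y -> S y /\ F y = G y].
Proof.
move=> [V oV SE] sF Sx; have [U [G [oU Ux sG GF]]] := sF x Sx.
exists (U `&` V), G; split.
- exact: openI.
- by split=> //; move: Sx; rewrite SE => -[].
- by move=> s y [Uy _]; exact: sG.
- move=> y [Uy Vy] hy; have Sy : S y by rewrite SE.
  by rewrite GF.
Qed.

Lemma rpartial_ext U G F i x : open U -> U x -> halfspace x ->
  (forall y, U y -> halfspace y -> F y = G y) -> smooth_open U G ->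
  rpartial i F x = 'D_(delta_mx 0 i) G x.
Proof.
move=> oU Ux hx FG sG; rewrite (@eq_rpartial _ _ G) //.
  by rewrite rpartialE //; apply: diff_derivable; exact: (sG [::]).
by apply: filterS (open_nbhs_nbhs (conj oU Ux)) => y /FG.
Qed.

(** A one-sided derivative of [F] is the derivative of every local smooth
    extension of [F], on the boundary of the half-space as well, so a derivative of
    the extension extends it. *)
Lemma smooth_on_rpartial S F i :
  rel_open S -> smooth_on S F -> smooth_on S (rpartial i F).
Proof.
move=> oS sF x Sx; have [U [G [oU Ux sG UG]]] := smooth_on_ext oS sF Sx.
exists U, (fun y => 'D_(delta_mx 0 i) G y); split=> //.
  by move=> s y Uy; rewrite -iter_partial_rcons; exact: sG.
move=> y Uy Sy; symmetry; apply: (rpartial_ext _ oU Uy) => //.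
  exact: rel_open_half Sy.
by move=> z Uz /(UG z Uz)[].
Qed.

Lemma rpartialM S F G i x : rel_open S -> smooth_on S F -> smooth_on S G ->
  S x -> rpartial i (fun y => F y * G y) x
         = F x * rpartial i G x + G x * rpartial i F x.
Proof.
move=> oS sF sG Sx; have hx := rel_open_half oS Sx.
have [U [H [oU Ux sH UH]]] := smooth_on_ext oS sF Sx.
have [V [K [oV Vx sK VK]]] := smooth_on_ext oS sG Sx.
have dH : derivable H x (delta_mx 0 i) by apply/diff_derivable/(sH [::]).
have dK : derivable K x (delta_mx 0 i) by apply/diff_derivable/(sK [::]).
rewrite (@rpartial_ext _ _ F i x oU Ux hx _ sH); last first.
  by move=> y Uy /(UH y Uy)[].
rewrite (@rpartial_ext _ _ G i x oV Vx hx _ sK); last first.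
  by move=> y Vy /(VK y Vy)[].
transitivity (rpartial i (H * K) x); last first.
  rewrite (rpartialE (derivableM dH dK)) (deriveM dH dK).
  by rewrite (UH x Ux hx).2 (VK x Vx hx).2.
apply: eq_rpartial => //.
apply: filterS (open_nbhs_nbhs (conj (openI oU oV) (conj Ux Vx))).
move=> y [Uy Vy] hy.
by rewrite (UH y Uy hy).2 (VK y Vy hy).2.
Qed.

Lemma rpartialD S F G i x : rel_open S -> smooth_on S F -> smooth_on S G ->
  S x -> rpartial i (fun y => F y + G y) x = rpartial i F x + rpartial i G x.
Proof.
move=> oS sF sG Sx; have hx := rel_open_half oS Sx.
have [U [H [oU Ux sH UH]]] := smooth_on_ext oS sF Sx.
have [V [K [oV Vx sK VK]]] := smooth_on_ext oS sG Sx.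
have dH : derivable H x (delta_mx 0 i) by apply/diff_derivable/(sH [::]).
have dK : derivable K x (delta_mx 0 i) by apply/diff_derivable/(sK [::]).
rewrite (@rpartial_ext _ _ F i x oU Ux hx _ sH); last first.
  by move=> y Uy /(UH y Uy)[].
rewrite (@rpartial_ext _ _ G i x oV Vx hx _ sK); last first.
  by move=> y Vy /(VK y Vy)[].
transitivity (rpartial i (fun y => H y + K y) x); last first.
  rewrite (@rpartialE i (fun y => H y + K y)); last exact: derivableD.
  exact: deriveD.
apply: eq_rpartial => //.
apply: filterS (open_nbhs_nbhs (conj (openI oU oV) (conj Ux Vx))).
move=> y [Uy Vy] hy.
by rewrite (UH y Uy hy).2 (VK y Vy hy).2.
Qed.

Lemma rpartial_cst i (c : R) x : rpartial i (fun=> c) x = 0.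
Proof. by rewrite rpartialE ?derive_cst //; exact: derivable_cst. Qed.

Lemma rpartial_coord i k x : rpartial i (fun y => y 0 k) x = (i == k)%:R.
Proof.
have dk : differentiable (fun y : 'rV[R]_n => y 0 k : R) x.
  exact: differentiable_coord.
rewrite rpartialE; last by apply: diff_derivable.
apply: cvg_lim => //.
apply: (@cvg_trans _ (cst ((i == k)%:R : R) @ 0^')); last exact: cvg_cst.
apply: near_eq_cvg; near=> t.
have t0 : t != 0 by near: t; exact: nbhs_dnbhs_neq.
rewrite /= !mxE eqxx /= addrK [k == i]eq_sym.
by rewrite [RHS]mulKf.
Unshelve. all: by end_near. Qed.

End one_sided.

Section chain_rule.
Context {R : realType} {n : nat}.

Lemma derive_coords (F : 'rV[R]_n -> R) x (v : 'rV[R]_n) : differentiable F x ->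
  'D_v F x = \sum_k v 0 k * 'D_(delta_mx 0 k) F x.
Proof.
move=> dF; rewrite deriveE // {1}(row_sum_delta v) linear_sum /=.
by apply: eq_bigr => k _; rewrite linearZ /= deriveE.
Qed.

Lemma differentiable_row (T : 'rV[R]_n -> 'rV[R]_n) x :
  (forall k, differentiable (fun y => T y 0 k : R) x) -> differentiable T x.
Proof.
move=> dT.
have -> : T = \sum_k (fun y => T y 0 k *: (delta_mx 0 k : 'rV[R]_n)).
  by apply/funext => y; rewrite fct_sumE [LHS]row_sum_delta.
by apply: differentiable_sum => k; exact: differentiableZl.
Qed.

(** Chain rule, by way of smooth extensions of [T] and of [F]: the extension of
    [T] may leave the half-space, which is why both are extended. *)
Lemma rpartial_comp (S S' : set 'rV[R]_n) (T : 'rV[R]_n -> 'rV[R]_n)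
    (F : 'rV[R]_n -> R) i x :
  rel_open S -> rel_open S' -> (forall k, smooth_on S (fun y => T y 0 k)) ->
  (forall y, S y -> S' (T y)) -> smooth_on S' F -> S x ->
  rpartial i (F \o T) x
    = \sum_k rpartial i (fun y => T y 0 k) x * rpartial k F (T x).
Proof.
move=> oS oS' sT TS sF Sx; have hx := rel_open_half oS Sx.
have [U [G [oU Ux sG UG]]] := smooth_on_ext oS' sF (TS x Sx).
have /choice[P] k := smooth_on_ext oS (sT k) Sx.
move=> /choice[K PK].
pose K' y : 'rV[R]_n := \row_k K k y.
have KT y : (forall k, P k y) -> halfspace y -> K' y = T y.
  move=> Py hy; apply/rowP => k; rewrite mxE.
  by have [_ _ _ /(_ y (Py k) hy)[]] := PK k.
have Px k : P k x by have [] := PK k.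
have dK : differentiable K' x.
  apply: differentiable_row => k.
  have [_ _ sK _] := PK k.
  rewrite (_ : (fun _ => _) = K k); last by apply/funext => y; rewrite mxE.
  exact: (sK [::]).
have nP : \forall y \near x, forall k, P k y.
  apply: (@filter_forall _ _ P (nbhs x)) => k; have [oP _ _ _] := PK k.
  by apply: open_nbhs_nbhs; split.
have K'x : K' x = T x by exact: KT.
have dG : differentiable G (K' x) by rewrite K'x; exact: (sG [::]).
have nU : \forall y \near x, U (K' y).
  apply: (differentiable_continuous dK); rewrite K'x.
  exact: (open_nbhs_nbhs (conj oU Ux)).
rewrite (@eq_rpartial _ _ _ _ (G \o K')) //; last first.
  have nS := rel_open_near oS Sx.
  near=> y => hy /=; rewrite KT //; last by near: y.
  have Uy : U (T y) by rewrite -KT //; near: y.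
  apply: (UG _ Uy _).2; apply: (rel_open_half oS'); apply: TS.
  by move: hy; near: y.
rewrite rpartialE; last exact/diff_derivable/differentiable_comp.
rewrite deriveE; last exact: differentiable_comp.
rewrite diff_comp //= -!deriveE //.
rewrite derive_coords //; apply: eq_bigr => k _; congr (_ * _).
  rewrite derive_mx ?mxE; last exact: diff_derivable.
  have [oP Pkx sK PKy] := PK k.
  rewrite (@rpartial_ext _ _ _ _ (fun y => T y 0 k) i x oP Pkx hx _ sK); last first.
    by move=> y Py /(PKy y Py)[].
  by congr (derive _ _ _); apply/funext => y; rewrite mxE.
rewrite K'x (rpartial_ext k oU Ux _ _ sG) //.
  by apply: (rel_open_half oS'); exact: TS.
by move=> y Uy /(UG y Uy)[].
Unshelve. all: by end_near. Qed.

End chain_rule.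

(** * Changes of charts, smooth functions and smooth fields *)

Section charts.
Context {R : realType} {d : nat} {M : ptopologicalType}.
Variable A : M -> chart R d M.
Hypothesis hatlas : smooth_atlas A.
Implicit Types (h : M -> R) (X Y Z : M -> 'rV[R]_d) (m p q z : M).

Definition overlap p q : set 'rV[R]_d :=
  cmap (A p) @` (cdom (A p) `&` cdom (A q)).

Lemma cdom_self p : cdom (A p) p.
Proof. by have [_ /(_ p)] := hatlas. Qed.

Lemma cmapK p z : cdom (A p) z -> cinv (A p) (cmap (A p) z) = z.
Proof. by have [/(_ p)[_ _ + _ _] _ _] := hatlas; exact. Qed.

Lemma cimg_cmap p z : cdom (A p) z -> cimg (A p) (cmap (A p) z).
Proof. by exists z. Qed.

Lemma cimg_rel_open p : rel_open (cimg (A p)).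
Proof. by have [/(_ p)[]] := hatlas. Qed.

Lemma overlap_sub p q : overlap p q `<=` cimg (A p).
Proof. by move=> _ [z [pz _] <-]; exists z. Qed.

Lemma overlap_rel_open p q : rel_open (overlap p q).
Proof.
have [hA _ _] := hatlas.
have [_ [U oU pU] _ _ cinvp] := hA p; have [oq _ _ _ _] := hA q.
have /open_subspaceP[V oV VE] := (continuousP _).1 cinvp _ oq.
exists (U `&` V); first exact: openI.
have E : overlap p q = cimg (A p) `&` (cinv (A p) @^-1` cdom (A q)).
  rewrite eqEsubset; split=> [_ [z [pz qz] <-]|x [[z pz <-]]] /=.
    by split; [exact: cimg_cmap|rewrite /= cmapK].
  by rewrite /= cmapK // => qz; exists z.
by rewrite E setIC -VE pU setICA setIA.
Qed.

(** Jacobian at [z], with row vectors acting from the left, of the change of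
    coordinates from the chart [A p] to the chart [A q]. *)
Definition jac p q z : 'M[R]_d :=
  \matrix_(i, k) rpartial i (fun x => cmap (A q) (cinv (A p) x) 0 k)
                          (cmap (A p) z).

Lemma smooth_on_sub (S S' : set 'rV[R]_d) F :
  S' `<=` S -> smooth_on S F -> smooth_on S' F.
Proof.
move=> sS sF x /sS Sx; have [U [G [oU Ux sG GF]]] := sF x Sx.
by exists U, G; split=> // y Uy /sS; exact: GF.
Qed.

Lemma chart_chain p q h i z : cdom (A p) z -> cdom (A q) z ->
  smooth_on (overlap q p) (h \o cinv (A q)) ->
  rpartial i (h \o cinv (A p)) (cmap (A p) z)
    = \sum_k jac p q z i k * rpartial k (h \o cinv (A q)) (cmap (A q) z).
Proof.
move=> pz qz sh; have [_ _ smooth_pq] := hatlas.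
have oz : overlap p q (cmap (A p) z) by exists z.
pose T x := cmap (A q) (cinv (A p) x).
rewrite (@eq_rpartial _ _ _ _ ((h \o cinv (A q)) \o T)); last first.
- have := rel_open_near (overlap_rel_open p q) oz.
  apply: filterS => y /[apply] -[z' [pz' qz'] <-].
  by rewrite /T /= !cmapK.
- exact: rel_open_half (overlap_rel_open p q) oz.
rewrite (rpartial_comp i (overlap_rel_open p q) (overlap_rel_open q p) _ _ sh oz).
- by apply: eq_bigr => k _; rewrite mxE /T cmapK.
- exact: smooth_pq.
- by move=> _ [z' [pz' qz'] <-]; rewrite /T cmapK //; exists z'.
Qed.

Lemma jac_id p z : cdom (A p) z -> jac p p z = 1%:M.
Proof.
move=> pz; apply/matrixP => i k; rewrite !mxE -(rpartial_coord i k (cmap (A p) z)).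
apply: eq_rpartial; first exact: rel_open_half (cimg_rel_open p) (cimg_cmap pz).
have := rel_open_near (cimg_rel_open p) (cimg_cmap pz).
by apply: filterS => y /[apply] -[z' pz' <-]; rewrite cmapK.
Qed.

Lemma jacV p q z : cdom (A p) z -> cdom (A q) z ->
  jac p q z *m jac q p z = 1%:M.
Proof.
move=> pz qz; rewrite -(jac_id pz); apply/matrixP => i k; rewrite !mxE.
have [_ _ /(_ q p k) smooth_qp] := hatlas.
rewrite (@chart_chain p q (fun m => cmap (A p) m 0 k)) //.
by apply: eq_bigr => j _; rewrite !mxE.
Qed.

Definition grad p h z : 'cV[R]_d :=
  \col_i rpartial i (h \o cinv (A p)) (cmap (A p) z).

(** The change of charts acts on gradients by its Jacobian. *)
Lemma grad_chain p q h z : smooth_fun A h -> cdom (A p) z -> cdom (A q) z ->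
  grad p h z = jac p q z *m grad q h z.
Proof.
move=> sh pz qz; apply/colP => i; rewrite !mxE (chart_chain i pz qz).
  by apply: eq_bigr => k _; congr (_ * _); rewrite mxE.
by apply: smooth_on_sub (sh q); exact: overlap_sub.
Qed.

Lemma tappE m v h : tapp A m v h = (v *m grad m h m) 0 0.
Proof. by rewrite mxE; apply: eq_bigr => i _; rewrite mxE. Qed.

Lemma smooth_fieldP X : smooth_field A X <->
  forall p, smooth_mx (cimg (A p))
    (fun x => X (cinv (A p) x) *m jac (cinv (A p) x) p (cinv (A p) x)).
Proof.
have E p j x : (X (cinv (A p) x) *m jac (cinv (A p) x) p (cinv (A p) x)) 0 j
  = tapp A (cinv (A p) x) (X (cinv (A p) x)) (fun m' => cmap (A p) m' 0 j).
  by rewrite mxE; apply: eq_bigr => i _; rewrite mxE.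
split=> sX p.
  by move=> i j; apply: (eq_smooth_on _ (sX p j)) => x _; rewrite ord1 E.
by move=> j; apply: (eq_smooth_on _ (sX p 0 j)) => x _; rewrite E.
Qed.

Lemma eq_smooth_fun h h' : h =1 h' -> smooth_fun A h -> smooth_fun A h'.
Proof. by move=> /funext ->. Qed.

Lemma smooth_fun_cst (c : R) : smooth_fun A (fun=> c).
Proof. by move=> p; exact: smooth_on_cst. Qed.

Lemma smooth_funD h h' : smooth_fun A h -> smooth_fun A h' ->
  smooth_fun A (fun m => h m + h' m).
Proof. by move=> sh sh' p; exact: smooth_onD (sh p) (sh' p). Qed.

Lemma smooth_funM h h' : smooth_fun A h -> smooth_fun A h' ->
  smooth_fun A (fun m => h m * h' m).
Proof. by move=> sh sh' p; exact: smooth_onM (sh p) (sh' p). Qed.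

Lemma smooth_fun_sum (I : Type) (r : seq I) (F : I -> M -> R) :
  (forall i, smooth_fun A (F i)) ->
  smooth_fun A (fun m => \sum_(i <- r) F i m).
Proof. by move=> sF p; apply: smooth_on_sum => i _; exact: sF. Qed.

(** In the chart [A p] the function is a sum of products of the components of [X]
    and of the partial derivatives of [h]; its definition, which uses at each point
    the chart attached to that point, does not show any smoothness. *)
Lemma smooth_vapp X h : smooth_field A X -> smooth_fun A h ->
  smooth_fun A (vapp A X h).
Proof.
move=> /smooth_fieldP sX sh p.
pose H x := \sum_j (X (cinv (A p) x) *m jac (cinv (A p) x) p (cinv (A p) x)) 0 j
                   * rpartial j (h \o cinv (A p)) x.
apply: (@eq_smooth_on _ _ _ H) => [_ [z pz <-]|].
  rewrite /H /= cmapK // /vapp tappE (grad_chain sh (cdom_self z) pz) mulmxA.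
  by rewrite [RHS]mxE; apply: eq_bigr => j _; congr (_ * _); rewrite mxE.
apply: smooth_on_sum => j _; apply: smooth_onM; first exact: sX.
exact: smooth_on_rpartial (cimg_rel_open p) (sh p).
Qed.

Lemma tapp_linear m a (u v : 'rV[R]_d) h :
  tapp A m (a *: u + v) h = a * tapp A m u h + tapp A m v h.
Proof. by rewrite !tappE mulmxDl -scalemxAl !mxE. Qed.

Lemma tapp_cst m (v : 'rV[R]_d) c : tapp A m v (fun=> c) = 0.
Proof. by apply: big1 => i _; rewrite rpartial_cst mulr0. Qed.

Lemma tappD m (v : 'rV[R]_d) h h' : smooth_fun A h -> smooth_fun A h' ->
  tapp A m v (fun q => h q + h' q)
  = tapp A m v h + tapp A m v h'.
Proof.
move=> sh sh'; rewrite -big_split /=; apply: eq_bigr => i _.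
rewrite -mulrDr; congr (_ * _).
exact: (rpartialD i (cimg_rel_open m) (sh m) (sh' m) (cimg_cmap (cdom_self m))).
Qed.

Lemma tappM m (v : 'rV[R]_d) h h' : smooth_fun A h -> smooth_fun A h' ->
  tapp A m v (fun q => h q * h' q)
  = h m * tapp A m v h' + h' m * tapp A m v h.
Proof.
move=> sh sh'; rewrite 2!mulr_sumr -big_split /=; apply: eq_bigr => i _.
have := rpartialM i (cimg_rel_open m) (sh m) (sh' m) (cimg_cmap (cdom_self m)).
rewrite /= cmapK; last exact: cdom_self.
by move=> ->; rewrite mulrDr mulrCA [X in _ + X]mulrCA.
Qed.

Lemma tapp_sum (I : Type) (r : seq I) m (v : 'rV[R]_d) (F : I -> M -> R) :
  (forall i, smooth_fun A (F i)) ->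
  tapp A m v (fun q => \sum_(i <- r) F i q)
  = \sum_(i <- r) tapp A m v (F i).
Proof.
move=> sF; elim: r => [|i r IH].
  rewrite big_nil -[RHS](tapp_cst m v 0); congr tapp.
  by apply/funext => q; rewrite big_nil.
rewrite big_cons -IH -tappD //; last exact: smooth_fun_sum.
by congr tapp; apply/funext => q; rewrite big_cons.
Qed.

Lemma smooth_field_lin h X Y : smooth_fun A h ->
  smooth_field A X -> smooth_field A Y ->
  smooth_field A (fun m => h m *: X m + Y m).
Proof.
move=> sh sX sY p j.
apply: (eq_smooth_on _ (smooth_onD (smooth_onM (sh p) (sX p j)) (sY p j))) => x _.
by rewrite /= tapp_linear.
Qed.

Lemma smooth_field0 : smooth_field A (fun=> 0).
Proof.
move=> p j; apply: (eq_smooth_on _ (@smooth_on_cst _ _ _ 0)) => x _.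
by rewrite /= tappE mul0mx mxE.
Qed.

Lemma smooth_field_sum (I : Type) (r : seq I) (h : I -> M -> R)
    (Z : I -> M -> 'rV[R]_d) :
  (forall i, smooth_fun A (h i)) -> (forall i, smooth_field A (Z i)) ->
  smooth_field A (fun m => \sum_(i <- r) h i m *: Z i m).
Proof.
move=> sh sZ; elim: r => [|i r IH].
  rewrite (_ : (fun _ => _) = fun=> 0); first exact: smooth_field0.
  by apply/funext => m; rewrite big_nil.
rewrite (_ : (fun _ => _) =
  fun m => h i m *: Z i m + \sum_(j <- r) h j m *: Z j m).
  exact: smooth_field_lin.
by apply/funext => m; rewrite big_cons.
Qed.

(** When no smooth field extends the vector, the default is the zero field. *)
Lemma smooth_extend m v : smooth_field A (extend A m v).
Proof.
rewrite /extend; case: xgetP => [V _ [] //|_]; exact: smooth_field0.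
Qed.

Lemma smooth_fun_continuous h : smooth_fun A h -> continuous h.
Proof.
move=> sh m; have [hA _ _] := hatlas; have [om _ _ cmapm _] := hA m.
have cm := cdom_self m.
have [U [G [oU Ux sG UG]]] := smooth_on_ext (cimg_rel_open m) (sh m) (cimg_cmap cm).
have cG : {for cmap (A m) m, continuous G}.
  by apply: differentiable_continuous; exact: (sG [::]).
have cmapc : {for m, continuous (cmap (A m))}.
  have := cmapm; rewrite continuous_open_subspace // => /(_ m).
  by rewrite inE; apply.
have mdom : \forall q \near m, cdom (A m) q by exact: open_nbhs_nbhs.
have mU : \forall q \near m, U (cmap (A m) q).
  by apply: cmapc; exact: open_nbhs_nbhs.
have E : \forall q \near m, G (cmap (A m) q) = h q.
  near=> q; have dq : cdom (A m) q by near: q.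
  have Uq : U (cmap (A m) q) by near: q.
  have [_ <-] := UG _ Uq (rel_open_half (cimg_rel_open m) (cimg_cmap dq)).
  by rewrite /= cmapK.
have Em : G (cmap (A m) m) = h m by exact: nbhs_singleton E.
rewrite /continuous_at -Em; apply: cvg_trans (continuous_comp cmapc cG).
by apply: near_eq_cvg.
Unshelve. all: by end_near. Qed.

End charts.

(** * Hessians of an embedding *)

Section embedding.
Context {R : realType} {d D : nat} {M : ptopologicalType}.
Variable A : M -> chart R d M.
Hypothesis hatlas : smooth_atlas A.
Variable f : M -> 'rV[R]_D.
Hypothesis hf : smooth_embedding A f.
Implicit Types (h : M -> R) (U V X Y Z : M -> 'rV[R]_d) (m p q z : M).

Lemma smooth_component a : smooth_fun A (component f a).
Proof. by have [] := hf. Qed.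

(** Jacobian matrix of [f] in the chart [A p]. *)
Definition embed_mx p z : 'M[R]_(d, D) :=
  \matrix_(i, a) grad A p (component f a) z i 0.

Lemma differentialE m v : differential A f m v = v *m embed_mx m m.
Proof.
apply/rowP => a; rewrite !mxE; apply: eq_bigr => i _.
by congr (_ * _); rewrite !mxE.
Qed.

Lemma tangent_mxE m : tangent_mx A f m = embed_mx m m.
Proof.
by apply/row_matrixP => i; rewrite rowK differentialE -rowE.
Qed.

Lemma vapp_component V a m :
  vapp A V (component f a) m = (V m *m embed_mx m m) 0 a.
Proof. by rewrite -differentialE mxE. Qed.

Lemma embed_mx_chain p q z : cdom (A p) z -> cdom (A q) z ->
  embed_mx p z = jac A p q z *m embed_mx q z.
Proof.
move=> pz qz; apply/matrixP => i a.
rewrite mxE (grad_chain hatlas (@smooth_component a) pz qz) !mxE.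
by apply: eq_bigr => k _; congr (_ * _); rewrite [RHS]mxE.
Qed.

Lemma smooth_embed_mx p :
  smooth_mx (cimg (A p)) (fun x => embed_mx p (cinv (A p) x)).
Proof.
move=> i a.
have s := smooth_on_rpartial i (cimg_rel_open hatlas p) (@smooth_component a p).
apply: (eq_smooth_on _ s).
by move=> _ [z pz <-]; rewrite !mxE (cmapK hatlas).
Qed.

(** Injectivity of [df] at [z] is a statement about the chart attached to [z]; the
    invertible Jacobian carries it to [A p]. *)
Lemma embed_mx_free p z : cdom (A p) z -> row_free (embed_mx p z).
Proof.
move=> pz; have zz := cdom_self hatlas z.
have /row_freeP[B TB] : row_free (embed_mx z z).
  have [_ _ _ _ /(_ z) df_inj] := hf.
  rewrite -kermx_eq0 -submx0; apply/rV_subP => u /sub_kermxP uT.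
  rewrite submx0; apply/eqP/df_inj.
  by rewrite !differentialE uT mul0mx.
apply/row_freeP; exists (B *m jac A z p z).
rewrite (embed_mx_chain pz zz) -mulmxA [X in _ *m X]mulmxA TB mul1mx.
exact: jacV.
Qed.

(** The tangential projection of the constant vector [c], which is the gradient
    of the linear function [dot c] for the pullback metric. *)
Definition tangential_field (c : 'rV[R]_D) m : 'rV[R]_d :=
  c *m (embed_mx m m)^T *m invmx (embed_mx m m *m (embed_mx m m)^T).

(** The field has the same expression in every chart around the point. *)
Lemma tangential_field_jac c p z : cdom (A p) z ->
  tangential_field c z *m jac A z p z
  = c *m (embed_mx p z)^T *m invmx (embed_mx p z *m (embed_mx p z)^T).
Proof.
move=> pz; have zz := cdom_self hatlas z.
rewrite /tangential_field.
set T := embed_mx z z; set S := embed_mx p z; set J := jac A z p z.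
have uT : T *m T^T \in unitmx by apply: gram_unitmx; exact: embed_mx_free.
have uS : S *m S^T \in unitmx by apply: gram_unitmx; exact: embed_mx_free.
have TE : T = J *m S by exact: embed_mx_chain.
have [_ uJ] := mulmx1_unit (jacV hatlas pz zz).
apply: (can_inj (mulmxK uS)); rewrite mulmxKV //.
have uJt : J^T \in unitmx by rewrite unitmx_tr.
apply: (can_inj (mulmxK uJt)).
rewrite -[RHS]mulmxA -trmx_mul -TE -[LHS]mulmxA.
rewrite -[S *m S^T *m J^T]mulmxA -trmx_mul -TE.
by rewrite -[LHS]mulmxA [J *m _]mulmxA -TE mulmxKV.
Qed.

Lemma smooth_tangential_field c : smooth_field A (tangential_field c).
Proof.
apply/smooth_fieldP => p.
have sT := @smooth_embed_mx p.
have sG := smooth_mxM sT (smooth_mx_tr sT).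
have sc : smooth_mx (cimg (A p)) (fun=> c).
  by move=> i j; exact: smooth_on_cst.
have uG x : cimg (A p) x -> embed_mx p (cinv (A p) x)
    *m (embed_mx p (cinv (A p) x))^T \in unitmx.
  by move=> [z pz <-]; rewrite (cmapK hatlas) //; exact/gram_unitmx/embed_mx_free.
have := smooth_mxM (smooth_mxM sc (smooth_mx_tr sT)) (smooth_mxV uG sG).
move=> sZ i j; apply: (eq_smooth_on _ (sZ i j)) => _ [z pz <-].
by rewrite (cmapK hatlas) // tangential_field_jac.
Qed.

Lemma tangential_fieldK m v : tangential_field (v *m embed_mx m m) m = v.
Proof.
rewrite /tangential_field -[v *m _ *m _]mulmxA mulmxK //.
exact/gram_unitmx/embed_mx_free/cdom_self.
Qed.

(** Projecting the constant vector [df v] extends [v], so the fields chosen by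
    [extend] do take the prescribed values. *)
Lemma extendE m v : extend A m v m = v.
Proof.
suff [] : smooth_field A (extend A m v) /\ extend A m v m = v by [].
apply: (@xgetPex _ (fun=> 0) [set V | smooth_field A V /\ V m = v]).
exists (tangential_field (v *m embed_mx m m)); split.
  exact: smooth_tangential_field.
exact: tangential_fieldK.
Qed.

Let E a := tangential_field (delta_mx 0 a).

(** Projecting the components of [df V] back to the tangent spaces gives a
    global expansion of [V] over finitely many smooth fields, with smooth
    coefficients. *)
Lemma field_expansion V :
  V = fun m => \sum_a vapp A V (component f a) m *: E a m.
Proof.
apply/funext => m; rewrite -[LHS](tangential_fieldK m).
rewrite {1}[V m *m _]row_sum_delta /tangential_field !mulmx_suml.
apply: eq_bigr => a _.
by rewrite -vapp_component -!scalemxAl.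
Qed.

Section connection.
Variable nabla : (M -> 'rV[R]_d) -> (M -> 'rV[R]_d) -> M -> 'rV[R]_d.
Hypothesis hnabla : affine_connection A nabla.

(** The Hessian before evaluation at tangent vectors, as an operation on
    fields. *)
Definition hess U V m : 'rV[R]_D :=
  \row_a (vapp A U (vapp A V (component f a)) m
          - vapp A (nabla U V) (component f a) m).

Lemma hess_linl h U U' V m : smooth_fun A h ->
  smooth_field A U -> smooth_field A U' -> smooth_field A V ->
  hess (fun q => h q *: U q + U' q) V m = h m *: hess U V m + hess U' V m.
Proof.
move=> sh sU sU' sV; have [_ nl _ _] := hnabla.
apply/rowP => a; rewrite !mxE.
rewrite /vapp (nl h U U' V) // !tapp_linear.
by rewrite mulrBr opprD addrACA.
Qed.

Lemma hessDr U V V' m :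
  smooth_field A U -> smooth_field A V -> smooth_field A V' ->
  hess U (fun q => V q + V' q) m = hess U V m + hess U V' m.
Proof.
move=> sU sV sV'; have [_ _ nD _] := hnabla.
have tD q (u v : 'rV[R]_d) h : tapp A q (u + v) h = tapp A q u h + tapp A q v h.
  by rewrite -[u in LHS]scale1r tapp_linear mul1r.
apply/rowP => a; rewrite !mxE /vapp (nD U V V') // tD.
rewrite (_ : (fun _ => _) = fun q => vapp A V (component f a) q
                                    + vapp A V' (component f a) q).
  rewrite (tappD hatlas); last 2 first.
  - exact: (smooth_vapp hatlas sV (@smooth_component a)).
  - exact: (smooth_vapp hatlas sV' (@smooth_component a)).
  by rewrite opprD addrACA.
by apply/funext => q; rewrite tD.
Qed.

(** The terms in which the function is differentiated come once from each of
    [U (V f_a)] and [(nabla U V) f_a], and cancel. *)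
Lemma hessZr h U V m : smooth_fun A h -> smooth_field A U -> smooth_field A V ->
  hess U (fun q => h q *: V q) m = h m *: hess U V m.
Proof.
move=> sh sU sV; have [_ _ _ nZ] := hnabla.
have tZ q c (u : 'rV[R]_d) k : tapp A q (c *: u) k = c * tapp A q u k.
  by rewrite !tappE -scalemxAl mxE.
apply/rowP => a; rewrite !mxE /vapp (nZ h U V) // tapp_linear tZ.
rewrite (_ : (fun _ => _) = fun q => h q * vapp A V (component f a) q).
  rewrite (tappM hatlas) //; last first.
    exact: (smooth_vapp hatlas sV (@smooth_component a)).
  rewrite -!/(vapp A _ _ m) mulrBr opprD addrA addrAC.
  by rewrite [vapp A V _ m * _]mulrC addrK.
by apply/funext => q; rewrite tZ.
Qed.

Lemma hess0l V m : smooth_field A V -> hess (fun=> 0) V m = 0.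
Proof.
move=> sV; have s0 := @smooth_field0 _ _ _ A.
have := hess_linl (h := fun=> -1) m (@smooth_fun_cst _ _ _ A _) s0 s0 sV.
rewrite [RHS]/= [in RHS]scaleN1r [RHS]addNr => <-; congr (hess _ _ _).
by apply/funext => q; rewrite scaler0 addr0.
Qed.

Lemma hess0r U m : smooth_field A U -> hess U (fun=> 0) m = 0.
Proof.
move=> sU; have s0 := @smooth_field0 _ _ _ A.
have := hessZr (h := fun=> 0) m (@smooth_fun_cst _ _ _ A _) sU s0.
rewrite [RHS]scale0r => <-; congr (hess _ _ _).
by apply/funext => q; rewrite scale0r.
Qed.

Lemma hess_suml (I : Type) (r : seq I) (h : I -> M -> R)
    (X : I -> M -> 'rV[R]_d) V m :
  (forall i, smooth_fun A (h i)) -> (forall i, smooth_field A (X i)) ->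
  smooth_field A V ->
  hess (fun q => \sum_(i <- r) h i q *: X i q) V m
  = \sum_(i <- r) h i m *: hess (X i) V m.
Proof.
move=> sh sX sV; elim: r => [|i r IH].
  rewrite big_nil -[RHS](hess0l m sV); congr (hess _ _ _).
  by apply/funext => q; rewrite big_nil.
rewrite big_cons -IH -hess_linl //; last exact: smooth_field_sum.
by congr (hess _ _ _); apply/funext => q; rewrite big_cons.
Qed.

Lemma hess_sumr (I : Type) (r : seq I) (h : I -> M -> R)
    (X : I -> M -> 'rV[R]_d) U m :
  (forall i, smooth_fun A (h i)) -> (forall i, smooth_field A (X i)) ->
  smooth_field A U ->
  hess U (fun q => \sum_(i <- r) h i q *: X i q) m
  = \sum_(i <- r) h i m *: hess U (X i) m.
Proof.
move=> sh sX sU; elim: r => [|i r IH].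
  rewrite big_nil -[RHS](hess0r m sU); congr (hess _ _ _).
  by apply/funext => q; rewrite big_nil.
have sZ : smooth_field A (fun q => h i q *: X i q).
  have := smooth_field_lin (sh i) (sX i) (@smooth_field0 _ _ _ A).
  by congr smooth_field; apply/funext => q; rewrite addr0.
rewrite big_cons -IH -hessZr // -hessDr //; last exact: smooth_field_sum.
by congr (hess _ _ _); apply/funext => q; rewrite big_cons.
Qed.

(** Coefficients of the [c]-th component of the Hessian with respect to the
    spanning fields [E a]; they are far from unique, as there are [D] fields for
    [d] dimensions, but these ones are smooth. *)
Definition hess_coef c m : 'M[R]_D := \matrix_(a, b) hess (E a) (E b) m 0 c.

Lemma hess_tensorial U V m c : smooth_field A U -> smooth_field A V ->
  hess U V m 0 c
  = (U m *m embed_mx m m *m hess_coef c m *m (V m *m embed_mx m m)^T) 0 0.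
Proof.
move=> sU sV; have sE a : smooth_field A (E a) by exact: smooth_tangential_field.
have sh X a : smooth_field A X -> smooth_fun A (vapp A X (component f a)).
  by move=> sX; exact: (smooth_vapp hatlas sX (@smooth_component a)).
rewrite {1}(field_expansion V) hess_sumr //; last by move=> a; exact: sh.
rewrite [LHS]summxE [RHS]mxE; apply: eq_bigr => b _.
rewrite [LHS]mxE vapp_component [RHS]mulrC; congr (_ * _).
  by rewrite [RHS]mxE.
rewrite {1}(field_expansion U) hess_suml //; last by move=> a; exact: sh.
rewrite [LHS]summxE [RHS]mxE; apply: eq_bigr => a _.
by rewrite [LHS]mxE vapp_component; congr (_ * _); rewrite [RHS]mxE.
Qed.

Lemma smooth_hess_coef c a b : smooth_fun A (fun m => hess_coef c m a b).
Proof.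
have [nabla_smooth _ _ _] := hnabla.
have sE e : smooth_field A (E e) by exact: smooth_tangential_field.
have s1 : smooth_fun A (vapp A (E a) (vapp A (E b) (component f c))).
  apply: (smooth_vapp hatlas (sE a)).
  exact: (smooth_vapp hatlas (sE b) (@smooth_component c)).
have s2 : smooth_fun A (vapp A (nabla (E a) (E b)) (component f c)).
  by apply: (smooth_vapp hatlas _ (@smooth_component c)); exact: nabla_smooth.
apply: (eq_smooth_fun _ (smooth_funD s1
  (smooth_funM (@smooth_fun_cst _ _ _ A (-1)) s2))).
by move=> m; rewrite !mxE mulN1r.
Qed.

Lemma hessianE m u v :
  hessian A f nabla m u v = hess (extend A m u) (extend A m v) m.
Proof. by []. Qed.

End connection.

Section gauss.
Variable nablaf : (M -> 'rV[R]_d) -> (M -> 'rV[R]_d) -> M -> 'rV[R]_d.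
Hypothesis hnablaf : levi_civita A (pullback_metric A f) nablaf.

Lemma hessE (nabla : (M -> 'rV[R]_d) -> (M -> 'rV[R]_d) -> M -> 'rV[R]_d) U V m :
  hess nabla U V m
  = euclidean_derivative A f U V m - differential A f m (nabla U V m).
Proof. by apply/rowP => a; rewrite !mxE. Qed.

(** Differentiate [dot (df Y) (df Z)] along [X], by the product rule in [R^D] on
    one side and by metric compatibility on the other. *)
Lemma dot_hess_skew X Y Z m :
  smooth_field A X -> smooth_field A Y -> smooth_field A Z ->
  dot (hess nablaf X Y m) (differential A f m (Z m))
  = - dot (hess nablaf X Z m) (differential A f m (Y m)).
Proof.
move=> sX sY sZ; have [_ _ /(_ X Y Z sX sY sZ m)] := hnablaf.
have sh V a : smooth_field A V -> smooth_fun A (vapp A V (component f a)).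
  by move=> sV; exact: (smooth_vapp hatlas sV (@smooth_component a)).
rewrite {1}/vapp (_ : (fun _ => _) = fun q =>
    \sum_a vapp A Y (component f a) q * vapp A Z (component f a) q); last first.
  by apply/funext => q; apply: eq_bigr => a _; rewrite !mxE.
rewrite tapp_sum //; last by move=> a; apply: smooth_funM; exact: sh.
under eq_bigr => a _ do rewrite (tappM hatlas _ _ (sh Y a sY) (sh Z a sZ)).
rewrite big_split /= => E1.
have E2 : dot (euclidean_derivative A f X Y m) (differential A f m (Z m))
        + dot (euclidean_derivative A f X Z m) (differential A f m (Y m))
        = dot (differential A f m (nablaf X Y m)) (differential A f m (Z m))
        + dot (differential A f m (nablaf X Z m)) (differential A f m (Y m)).
  rewrite [X in _ = _ + X]dotC -[RHS]E1 addrC; congr (_ + _).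
    by apply: eq_bigr => a _; rewrite !mxE mulrC.
  by apply: eq_bigr => a _; rewrite !mxE mulrC.
have dotN (u v : 'rV[R]_D) : dot (- u) v = - dot u v.
  by rewrite !dotE mulNmx mxE.
rewrite !hessE !dotDl !dotN; apply/eqP.
by rewrite -subr_eq0 opprK addrACA E2 -opprD subrr.
Qed.

(** The connection and the Euclidean derivative have the same antisymmetric part,
    the Lie bracket. *)
Lemma hess_sym X Y m : smooth_field A X -> smooth_field A Y ->
  hess nablaf X Y m = hess nablaf Y X m.
Proof.
move=> sX sY; have [_ tor _] := hnablaf; apply/rowP => a; rewrite !mxE.
have := tor X Y _ sX sY (@smooth_component a) m.
move=> torE; apply/eqP; rewrite -subr_eq0 opprB [X in _ + X]addrC addrACA -torE.
by rewrite [X in _ + X]addrC -[X in _ + X]opprB subrr.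
Qed.

(** A trilinear form that is symmetric in its first two and antisymmetric in its
    last two arguments vanishes: this is the uniqueness argument for the
    Levi-Civita connection, and it identifies the tangential part of the
    Euclidean derivative. *)
Lemma dot_hess0 X Y Z m :
  smooth_field A X -> smooth_field A Y -> smooth_field A Z ->
  dot (hess nablaf X Y m) (differential A f m (Z m)) = 0.
Proof.
move=> sX sY sZ; apply/eqP; rewrite -eqNr; apply/eqP.
rewrite {2}dot_hess_skew // hess_sym // dot_hess_skew // opprK.
rewrite hess_sym // dot_hess_skew // hess_sym //.
Qed.

Lemma hess_normal X Y m : smooth_field A X -> smooth_field A Y ->
  hess nablaf X Y m *m (tangent_mx A f m)^T = 0.
Proof.
move=> sX sY; apply/rowP => i; rewrite mxE [RHS]mxE.
have := dot_hess0 m sX sY (@smooth_extend _ _ _ A m (delta_mx 0 i)).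
rewrite extendE => E0; rewrite -[RHS]E0; apply: eq_bigr => a _.
by congr (_ * _); rewrite [LHS]mxE [LHS]mxE.
Qed.

Lemma second_fundamental_formE m u v :
  second_fundamental_form A f m u v = hessian A f nablaf m u v.
Proof.
have sU := @smooth_extend _ _ _ A m u; have sV := @smooth_extend _ _ _ A m v.
rewrite /second_fundamental_form /tensor_at hessianE.
have := hessE nablaf (extend A m u) (extend A m v) m => /esym/(canRL (subrK _)) ->.
rewrite normal_partD differentialE -tangent_mxE normal_part_tangent addr0.
by rewrite normal_part_normal //; exact: hess_normal.
Qed.

End gauss.
End embedding.

(** * Sums over orthonormal frames *)

Section frames.
Context {R : realType} {d D : nat} {M : ptopologicalType}.
Variable A : M -> chart R d M.
Hypothesis hatlas : smooth_atlas A.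
Variable f : M -> 'rV[R]_D.
Hypothesis hf : smooth_embedding A f.
Variable g : M -> 'rV[R]_d -> 'rV[R]_d -> R.
Hypothesis hg : riemannian_metric A g.
Variable e : M -> 'I_d -> 'rV[R]_d.
Hypothesis he : forall m, orthonormal_frame g m (e m).
Implicit Types (m p z : M).

Definition metric_mx m : 'M[R]_d :=
  \matrix_(i, j) g m (delta_mx 0 i) (delta_mx 0 j).

Lemma metricE m u v : g m u v = (u *m metric_mx m *m v^T) 0 0.
Proof.
have [glin gsym _ _] := hg.
have g0 w : g m 0 w = 0.
  by have := glin m (-1) 0 0 w; rewrite scaler0 addr0 mulN1r addNr.
have gsum (I : Type) (r : seq I) (c : I -> R) (x : I -> 'rV[R]_d) w :
    g m (\sum_(i <- r) c i *: x i) w = \sum_(i <- r) c i * g m (x i) w.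
  elim: r => [|i r IH]; first by rewrite !big_nil g0.
  by rewrite !big_cons glin IH.
rewrite gsym {1}(row_sum_delta v) gsum [RHS]mxE; apply: eq_bigr => j _.
rewrite gsym {1}(row_sum_delta u) gsum [RHS]mulrC; congr (_ * _).
  by rewrite mxE.
by rewrite [RHS]mxE; apply: eq_bigr => i _; rewrite [in RHS]mxE.
Qed.

Lemma orthonormal_frameP m (b : 'I_d -> 'rV[R]_d) : orthonormal_frame g m b ->
  (\matrix_i b i) *m metric_mx m *m (\matrix_i b i)^T = 1%:M.
Proof.
move=> hb; apply/matrixP => i k; rewrite [RHS]mxE -hb metricE.
rewrite [LHS]mxE [RHS]mxE; apply: eq_bigr => j _.
congr (_ * _); last by rewrite !mxE.
by rewrite [LHS]mxE [RHS]mxE; apply: eq_bigr => l _; rewrite [in LHS]mxE.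
Qed.

(** [B G B^T = 1] for square matrices also gives [(B^T B) G = 1]: the product
    [B^T B] is the same for all orthonormal frames. *)
Lemma metric_mx_frame m (b : 'I_d -> 'rV[R]_d) : orthonormal_frame g m b ->
  metric_mx m \in unitmx
  /\ (\matrix_i b i)^T *m (\matrix_i b i) = invmx (metric_mx m).
Proof.
move=> /orthonormal_frameP; set B := \matrix_i b i => BG.
have [] := mulmx1_unit BG; rewrite unitmx_mul => /andP[uB uG] uBt.
split=> //; apply: (can_inj (mulmxK uG)); rewrite mulVmx //.
have := mulmx1C BG; rewrite !mulmxA; exact.
Qed.

(** The metric induced by [g] on covectors, read through [f]: the entry at
    [(a, b)] is the product of the differentials of the components [f_a] and
    [f_b]. *)
Definition cometric_mx m : 'M[R]_D :=
  (embed_mx A f m m)^T *m invmx (metric_mx m) *m embed_mx A f m m.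

Lemma gram_jac p z :
  gram A g p z = jac A p z z *m metric_mx z *m (jac A p z z)^T.
Proof.
apply/matrixP => i j; rewrite [LHS]mxE metricE.
rewrite [LHS]mxE [RHS]mxE; apply: eq_bigr => k _.
congr (_ * _); last by rewrite !mxE.
rewrite [LHS]mxE [RHS]mxE; apply: eq_bigr => l _.
by congr (_ * _); rewrite !mxE.
Qed.

Lemma gram_unit p z : cdom (A p) z -> gram A g p z \in unitmx.
Proof.
move=> pz; have [uG _] := metric_mx_frame (he z).
have [uJ _] := mulmx1_unit (jacV hatlas pz (cdom_self hatlas z)).
by rewrite gram_jac !unitmx_mul unitmx_tr uJ uG.
Qed.

(** Independence of the chart: [gram A g p z] and [embed_mx A f p z] change by the
    same Jacobian, which cancels. *)
Lemma cometric_chart p z : cdom (A p) z ->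
  cometric_mx z
  = (embed_mx A f p z)^T *m invmx (gram A g p z) *m embed_mx A f p z.
Proof.
move=> pz; have zz := cdom_self hatlas z.
have [uG _] := metric_mx_frame (he z).
have [uJ _] := mulmx1_unit (jacV hatlas pz zz).
rewrite (embed_mx_chain hatlas hf pz zz) gram_jac /cometric_mx.
set T := embed_mx A f z z; set J := jac A p z z; set G := metric_mx z.
have uJt : J^T \in unitmx by rewrite unitmx_tr.
have -> : invmx (J *m G *m J^T) = invmx J^T *m invmx G *m invmx J.
  have uH : J *m G *m J^T \in unitmx by rewrite !unitmx_mul uJ uG uJt.
  apply: (can_inj (mulmxK uH)); rewrite mulVmx //.
  by rewrite !mulmxA mulmxKV // mulmxKV // mulVmx.
by rewrite trmx_mul !mulmxA mulmxK // mulmxKV.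
Qed.

Definition smooth_fun_mx n k (B : M -> 'M[R]_(n, k)) :=
  forall i j, smooth_fun A (fun m => B m i j).

Lemma smooth_cometric : smooth_fun_mx cometric_mx.
Proof.
move=> a b p.
have sT := @smooth_embed_mx _ _ _ _ _ hatlas _ hf p.
have sG : smooth_mx (cimg (A p)) (fun x => gram A g p (cinv (A p) x)).
  by have [_ _ _ sgram] := hg; move=> i j; exact: sgram.
have uG x : cimg (A p) x -> gram A g p (cinv (A p) x) \in unitmx.
  by move=> [z pz <-]; rewrite (cmapK hatlas) // gram_unit.
have s := smooth_mxM (smooth_mxM (smooth_mx_tr sT) (smooth_mxV uG sG)) sT.
apply: (eq_smooth_on _ (s a b)) => _ [z pz <-].
by rewrite /= (cmapK hatlas) // (cometric_chart pz).
Qed.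

Lemma smooth_fun_mxM n k l (B : M -> 'M[R]_(n, k)) (C : M -> 'M[R]_(k, l)) :
  smooth_fun_mx B -> smooth_fun_mx C -> smooth_fun_mx (fun m => B m *m C m).
Proof.
move=> sB sC i j p.
apply: (smooth_mxM (B := fun x => B (cinv (A p) x))
                   (C := fun x => C (cinv (A p) x))) => a b.
  exact: sB.
exact: sC.
Qed.

(** Squared norm of the tensor whose [c]-th component has the matrix [C c] in
    the spanning family of covectors [df_1, ..., df_D]. *)
Definition tensor_norm2 (C : 'I_D -> M -> 'M[R]_D) m : R :=
  \sum_c \tr (cometric_mx m *m C c m *m cometric_mx m *m (C c m)^T).

Lemma smooth_tensor_norm2 C : (forall c, smooth_fun_mx (C c)) ->
  smooth_fun A (tensor_norm2 C).
Proof.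
move=> sC; apply: smooth_fun_sum => c; apply: smooth_fun_sum => a.
have sK := smooth_cometric.
have sCt : smooth_fun_mx (fun m => (C c m)^T).
  move=> i j; apply: (eq_smooth_fun _ (sC c j i)) => m.
  by rewrite mxE.
exact: (smooth_fun_mxM (smooth_fun_mxM (smooth_fun_mxM sK (sC c)) sK) sCt).
Qed.

Lemma sum_sqr_mxtrace n k (B : 'M[R]_(n, k)) :
  \sum_i \sum_j B i j ^+ 2 = \tr (B *m B^T).
Proof.
apply: eq_bigr => i _; rewrite mxE; apply: eq_bigr => j _.
by rewrite mxE expr2.
Qed.

(** With [N] the matrix of the differentials of the frame vectors, the left side
    is the sum of the squared entries of the matrices [N C N^T], and [N^T N] is
    the cometric whatever the frame. *)
Lemma frame_sumE C (Q : 'rV[R]_d -> 'rV[R]_d -> 'rV[R]_D) m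
    (b : 'I_d -> 'rV[R]_d) :
  orthonormal_frame g m b ->
  (forall u v c, Q u v 0 c
     = (u *m embed_mx A f m m *m C c m *m (v *m embed_mx A f m m)^T) 0 0) ->
  \sum_i \sum_k enorm2 (Q (b i) (b k)) = tensor_norm2 C m.
Proof.
move=> hb QE; set T := embed_mx A f m m.
pose N := (\matrix_i b i) *m T.
have NN : N^T *m N = cometric_mx m.
  have [_ BB] := metric_mx_frame hb.
  by rewrite /cometric_mx -BB trmx_mul !mulmxA.
transitivity (\sum_i \sum_k \sum_c (N *m C c m *m N^T) i k ^+ 2).
  apply: eq_bigr => i _; apply: eq_bigr => k _; apply: eq_bigr => c _.
  rewrite -expr2 QE; congr (_ ^+ 2).
  rewrite -[b i](rowK b) -[b k](rowK b) -!row_mul -/N.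
  rewrite 2![LHS]mxE [RHS]mxE; apply: eq_bigr => j _.
  by congr (_ * _); rewrite !mxE.
clearbody N; rewrite exchange_big /=.
under eq_bigr => k _ do rewrite exchange_big /=.
rewrite exchange_big /=; apply: eq_bigr => c _; rewrite exchange_big /=.
rewrite sum_sqr_mxtrace !trmx_mul trmxK -NN.
by rewrite !mulmxA [LHS]mxtrace_mulC !mulmxA.
Qed.

Lemma onbP m : orthonormal_frame g m (onb g m).
Proof.
have ex_frame := ex_intro (orthonormal_frame g m) _ (he m).
exact: (@xgetPex _ (fun=> 0) (orthonormal_frame g m) ex_frame).
Qed.

End frames.

Section measurability.
Context {R : realType} {M : ptopologicalType}.

Lemma continuous_borel (h : M -> R) : continuous h ->
  measurable_fun [set: borel M] (h : borel M -> R).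
Proof.
move=> ch; apply: (measurability _ (RGenOpens.measurableE R)) => //.
move=> _ [_ [a [b ->]] <-]; rewrite setTI; apply: sub_sigma_algebra.
by move/continuousP : ch; apply; exact: interval_open.
Qed.

End measurability.

(** * The decomposition of the Hessian *)

Section energies.
Context {R : realType} {d D : nat} {M : ptopologicalType}.
Variable A : M -> chart R d M.
Hypothesis hatlas : smooth_atlas A.
Variable f : M -> 'rV[R]_D.
Hypothesis hf : smooth_embedding A f.
Variables nabla nablaf :
  (M -> 'rV[R]_d) -> (M -> 'rV[R]_d) -> M -> 'rV[R]_d.
Hypothesis hnabla : affine_connection A nabla.
Hypothesis hnablaf : levi_civita A (pullback_metric A f) nablaf.

Let C c m := hess_coef A f nabla c m.
Let Cf c m := hess_coef A f nablaf c m.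

Lemma hessian_coefE m u v c : hessian A f nabla m u v 0 c
  = (u *m embed_mx A f m m *m C c m *m (v *m embed_mx A f m m)^T) 0 0.
Proof.
have sU := @smooth_extend _ _ _ A m u; have sV := @smooth_extend _ _ _ A m v.
by rewrite hessianE (hess_tensorial hatlas hf hnabla m c sU sV) !(extendE hatlas hf).
Qed.

Lemma second_fundamental_form_coefE m u v c :
  second_fundamental_form A f m u v 0 c
  = (u *m embed_mx A f m m *m Cf c m *m (v *m embed_mx A f m m)^T) 0 0.
Proof.
have [af _ _] := hnablaf.
have sU := @smooth_extend _ _ _ A m u; have sV := @smooth_extend _ _ _ A m v.
rewrite (second_fundamental_formE hatlas hf hnablaf) hessianE.
by rewrite (hess_tensorial hatlas hf af m c sU sV) !(extendE hatlas hf).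
Qed.

Lemma hessian_split m u v : hessian A f nabla m u v
  = second_fundamental_form A f m u v
    + differential A f m (connection_difference A nablaf nabla m u v).
Proof.
rewrite (second_fundamental_formE hatlas hf hnablaf) !hessianE !hessE.
rewrite /connection_difference /tensor_at !differentialE mulmxBl.
by rewrite addrA subrK.
Qed.

Lemma second_fundamental_form_orth m u v (w : 'rV[R]_d) :
  dot (second_fundamental_form A f m u v) (differential A f m w) = 0.
Proof.
have sU := @smooth_extend _ _ _ A m u; have sV := @smooth_extend _ _ _ A m v.
rewrite (second_fundamental_formE hatlas hf hnablaf) hessianE dotE differentialE.
rewrite trmx_mul mulmxA -tangent_mxE (hess_normal hatlas hf hnablaf _ sU sV).
by rewrite mul0mx mxE.
Qed.

Lemma difference_coefE m u v c :
  differential A f m (connection_difference A nablaf nabla m u v) 0 c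
  = (u *m embed_mx A f m m *m (C c m - Cf c m)
       *m (v *m embed_mx A f m m)^T) 0 0.
Proof.
have /esym/(canRL (addKr _)) -> := hessian_split m u v.
rewrite mxE [X in X + _]mxE hessian_coefE second_fundamental_form_coefE.
by rewrite mulmxBr mulmxBl [RHS]mxE [X in _ = _ + X]mxE addrC.
Qed.

End energies.

(** * The theorem *)

Unset Implicit Arguments.
Set Strict Implicit.

Theorem mainTheorem5 (R : realType) (d D : nat) (hd : (d < minn 4 D)%N)
  (M : ptopologicalType) (A : M -> chart R d M)
  (hT2 : hausdorff_space M) (hcount : @second_countable M)
  (hatlas : smooth_atlas A)
  (hcompact : compact [set: M]) (hconnected : connected [set: M])
  (horientable : orientable A)
  (g : M -> 'rV[R]_d -> 'rV[R]_d -> R) (hg : riemannian_metric A g)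
  (vol : {measure set (borel M) -> \bar R}) (hvol : riemannian_volume A g vol)
  (f : M -> 'rV[R]_D) (hf : smooth_embedding A f)
  (nabla nablaf : (M -> 'rV[R]_d) -> (M -> 'rV[R]_d) -> M -> 'rV[R]_d)
  (hnabla : levi_civita A g nabla)
  (hnablaf : levi_civita A (pullback_metric A f) nablaf)
  (e : M -> 'I_d -> 'rV[R]_d) (he : forall m, orthonormal_frame g m (e m)) :
  let W (i k : 'I_d) (m : borel M) : R :=
    enorm2 (differential A f m
      (connection_difference A nablaf nabla m (e m i) (e m k))) in
  (L2norm2 g vol (hessian A f nabla)
     = L2norm2 g vol (second_fundamental_form A f)
       + \int[vol]_m (\sum_i \sum_k W i k m)%:E)%E
  /\
  ((forall i k, measurable_fun [set: borel M] (W i k)) ->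
   (L2norm2 g vol (hessian A f nabla)
     = L2norm2 g vol (second_fundamental_form A f)
       + \sum_i \sum_k \int[vol]_m (W i k m)%:E)%E).
Proof.
have [an _ _] := hnabla; have [af _ _] := hnablaf.
pose C c m := hess_coef A f nabla c m.
pose Cf c m := hess_coef A f nablaf c m.
pose Cd c m := C c m - Cf c m.
pose N := tensor_norm2 A f g.
have NH m b : orthonormal_frame g m b ->
    \sum_i \sum_k enorm2 (hessian A f nabla m (b i) (b k)) = N C m.
  move=> hb; apply: (frame_sumE hg (C := C) (Q := hessian A f nabla m) hb).
  by move=> u v c; exact: hessian_coefE.
have NII m b : orthonormal_frame g m b ->
    \sum_i \sum_k enorm2 (second_fundamental_form A f m (b i) (b k)) = N Cf m.
  move=> hb.
  apply: (frame_sumE hg (C := Cf) (Q := second_fundamental_form A f m) hb).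
  by move=> u v c; exact: second_fundamental_form_coefE.
have ND m b : orthonormal_frame g m b ->
    \sum_i \sum_k enorm2 (differential A f m
      (connection_difference A nablaf nabla m (b i) (b k))) = N Cd m.
  move=> hb; apply: (frame_sumE hg (C := Cd) (Q := fun u v =>
    differential A f m (connection_difference A nablaf nabla m u v)) hb).
  by move=> u v c; exact: difference_coefE.
have split m : N C m = N Cf m + N Cd m.
  rewrite -(NH m _ (he m)) -(NII m _ (he m)) -(ND m _ (he m)).
  rewrite -big_split /=; apply: eq_bigr => i _.
  rewrite -big_split /=; apply: eq_bigr => k _.
  rewrite (hessian_split hatlas hf nabla hnablaf) enorm2D_orth //.
  exact: (second_fundamental_form_orth hatlas hf hnablaf).
have sC c : smooth_fun_mx A (C c) by move=> a b; exact: smooth_hess_coef.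
have sCf c : smooth_fun_mx A (Cf c) by move=> a b; exact: smooth_hess_coef.
have sCd c : smooth_fun_mx A (Cd c).
  move=> a b; apply: (eq_smooth_fun _ (smooth_funD (sC c a b)
    (smooth_funM (@smooth_fun_cst _ _ _ A (-1)) (sCf c a b)))) => m.
  by rewrite [RHS]mxE [X in _ = _ + X]mxE mulN1r.
have mN B : (forall c, smooth_fun_mx A (B c)) ->
    measurable_fun [set: borel M] (N B : borel M -> R).
  move=> sB; apply: continuous_borel.
  apply: (smooth_fun_continuous hatlas).
  exact: (smooth_tensor_norm2 hatlas hf hg he sB).
have NII_ge0 m : 0 <= N Cf m.
  rewrite -(NII m _ (he m)); apply: sumr_ge0 => i _; apply: sumr_ge0 => k _.
  exact: enorm2_ge0.
have ND_ge0 m : 0 <= N Cd m.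
  rewrite -(ND m _ (he m)); apply: sumr_ge0 => i _; apply: sumr_ge0 => k _.
  exact: enorm2_ge0.
move=> W.
have main : (L2norm2 g vol (hessian A f nabla)
     = L2norm2 g vol (second_fundamental_form A f)
       + \int[vol]_m (\sum_i \sum_k W i k m)%:E)%E.
  transitivity (\int[vol]_m ((N Cf m)%:E + (N Cd m)%:E))%E.
    apply: eq_integral => m _; rewrite -EFinD -split; congr (_%:E).
    exact: NH (onbP he m).
  rewrite ge0_integralD //; last 4 first.
  - by move=> m _; rewrite lee_fin.
  - by apply/measurable_EFinP; exact: mN.
  - by move=> m _; rewrite lee_fin.
  - by apply/measurable_EFinP; exact: mN.
  congr (_ + _)%E; apply: eq_integral => m _; congr (_%:E).
    by rewrite NII //; exact: onbP he m.
  by rewrite -(ND m _ (he m)).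
split=> // mW; rewrite main; congr (_ + _)%E.
under eq_integral => m _ do rewrite -sumEFin.
rewrite ge0_integral_sum //; last 2 first.
- move=> i; apply/measurable_EFinP; apply: measurable_sum => k; exact: mW.
- move=> i m _; rewrite lee_fin; apply: sumr_ge0 => k _; exact: enorm2_ge0.
apply: eq_bigr => i _; under eq_integral => m _ do rewrite -sumEFin.
rewrite ge0_integral_sum //.
- by move=> k; apply/measurable_EFinP; exact: mW.
- by move=> k m _; rewrite lee_fin; exact: enorm2_ge0.
Qed.
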